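(* Every presentation $\mathcal{P} \in \mathcal{B}$ defines a group $\hat{G}$ with weight one, infinite cyclic abelianization, and deficiency one. Furthermore, if $\mathcal{P}$ is the composition of the deficiency one presentation $\mathcal{G} = \langle \mathbf{u} : \mathbf{v}\rangle$ of $\mathbb{Z}$ with a balanced presentation of the trivial group, then the natural map $\varepsilon : \mathbb{Z} \to \hat{G}$ is injective.
   Context: All presentations are finite. The deficiency of a finite presentation is the number of generators minus the number of relators; the deficiency of a finitely presented group is the maximum deficiency over all its finite presentations. The weight of a group is the least number of elements whose normal closure is the whole group (the trivial group has weight zero). A presentation is balanced if it has deficiency zero. Given presentations $\mathcal{G} = \langle \mathbf{u} : \mathbf{v} \rangle$ and $\mathcal{H} = \langle \mathbf{x} : \mathbf{s} \rangle$ with $|\mathbf{u}| = |\mathbf{s}|$, a composition of $\mathcal{G}$ with $\mathcal{H}$ is the presentation $\langle \mathbf{x} : \varepsilon(\mathbf{v}) \rangle$, where $\varepsilon : F(\mathbf{u}) \to F(\mathbf{x})$ is the homomorphism extending a bijection $\mathbf{u} \to \mathbf{s}$; the natural map is the induced homomorphism $\varepsilon$ from the group presented by $\mathcal{G}$ to the group presented by the composition. $\mathcal{B}$ is the set of all presentations obtained by composing a deficiency one presentation $\mathcal{G}$ of the infinite cyclic group $\mathbb{Z}$ with a balanced presentation $\mathcal{H}$ of the trivial group having the same number of generators as $\mathcal{G}$. *)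

(* Defs.v *)
From HB Require Import structures.
From mathcomp Require Import all_boot all_order all_algebra.
From mathcomp Require Import boolp classical_sets.

Set Implicit Arguments.
Unset Strict Implicit.
Unset Printing Implicit Defensive.

Import Algebra.
Local Open Scope quotient_scope.
Local Open Scope classical_set_scope.
Local Open Scope group_scope.

(* Groups are the (possibly infinite) [groupType]s of MathComp; the group of
   integers is [to_multiplicative int], i.e. int with its addition. *)

Definition isomorphic (G H : groupType) : Prop :=
  exists f : {multiplicative G -> H}, bijective f.

Definition infinite_cyclic (G : groupType) : Prop :=
  isomorphic G (to_multiplicative int).

Definition trivial_group (G : groupType) : Prop := forall x : G, x = 1.

Lemma morph_one (G H : groupType) (f : G -> H) :
  {morph f : x y / x * y} -> f 1 = 1.
Proof. by move=> fM; apply: (mulgI (f 1)); rewrite -fM !mulg1. Qed.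

Definition is_subgroup (G : groupType) (N : set G) : Prop :=
  [/\ N 1, (forall x y, N x -> N y -> N (x * y)) & (forall x, N x -> N x^-1)].

Definition is_normal_subgroup (G : groupType) (N : set G) : Prop :=
  is_subgroup N /\ (forall x y, N x -> N (x ^ y)).

Record normal_subgroup (G : groupType) := NormalSubgroup {
  normal_carrier :> set G;
  normal_carrierP : is_normal_subgroup normal_carrier }.

Section Quotient.
Variables (G : groupType) (N : normal_subgroup G).

Definition coset_rel : rel G := fun x y => `[< normal_carrier N (x / y) >].

Let N1 : normal_carrier N 1. Proof. by case: N => ? [[]]. Qed.
Let NM x y :
  normal_carrier N x -> normal_carrier N y -> normal_carrier N (x * y).
Proof. by case: N => M /= [[? h ?] ?]; exact: h. Qed.
Let NV x : normal_carrier N x -> normal_carrier N x^-1.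
Proof. by case: N => M /= [[? ? h] ?]; exact: h. Qed.
Let NJ x y : normal_carrier N x -> normal_carrier N (x ^ y).
Proof. by case: N => M /= [? h]; exact: h. Qed.

Lemma coset_rel_refl : reflexive coset_rel.
Proof. by move=> x; apply/asboolP; rewrite mulgV. Qed.

Lemma coset_rel_sym : symmetric coset_rel.
Proof.
by move=> x y; apply/idP/idP => /asboolP/NV; rewrite invgF => ?; apply/asboolP.
Qed.

Lemma coset_rel_trans : transitive coset_rel.
Proof.
move=> y x z /asboolP h1 /asboolP h2; apply/asboolP.
by have := NM h1 h2; rewrite mulgA mulgVK.
Qed.

Canonical coset_equiv := EquivRel coset_rel coset_rel_refl coset_rel_sym coset_rel_trans.

Definition quotient_group := {eq_quot coset_equiv}.

HB.instance Definition _ := Choice.on quotient_group.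
HB.instance Definition _ := Quotient.on quotient_group.

Definition quotient_proj (x : G) : quotient_group := \pi x.

Lemma quotient_projP x y : quotient_proj x = quotient_proj y <-> normal_carrier N (x / y).
Proof. by split=> [/eqmodP/asboolP //|h]; apply/eqmodP/asboolP. Qed.

Definition quotient_one : quotient_group := quotient_proj 1.
Definition quotient_mul (a b : quotient_group) : quotient_group :=
  quotient_proj (repr a * repr b).
Definition quotient_inv (a : quotient_group) : quotient_group :=
  quotient_proj (repr a)^-1.

Lemma quotient_proj_repr (a : quotient_group) : quotient_proj (repr a) = a.
Proof. exact: reprK. Qed.

Lemma quotient_proj_mul x y :
  quotient_mul (quotient_proj x) (quotient_proj y) = quotient_proj (x * y).
Proof.
apply/quotient_projP.
have /quotient_projP hx := quotient_proj_repr (quotient_proj x).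
have /quotient_projP hy := quotient_proj_repr (quotient_proj y).
set x' := repr _ in hx *; set y' := repr _ in hy *.
have := NM hx (NJ x^-1 hy).
by rewrite conjgE invgK invgM !mulgA mulgVK.
Qed.

Lemma quotient_proj_inv x :
  quotient_inv (quotient_proj x) = quotient_proj x^-1.
Proof.
apply/quotient_projP.
have /quotient_projP hx := quotient_proj_repr (quotient_proj x).
set x' := repr _ in hx *.
have := NJ x (NV hx).
by rewrite invgF conjgE invgK -!mulgA mulKg.
Qed.

Lemma quotient_mulA : associative quotient_mul.
Proof.
move=> a b c; rewrite -(quotient_proj_repr a) -(quotient_proj_repr b).
by rewrite -(quotient_proj_repr c) !quotient_proj_mul mulgA.
Qed.

Lemma quotient_mul1g : left_id quotient_one quotient_mul.
Proof. by move=> a; rewrite -(quotient_proj_repr a) quotient_proj_mul mul1g. Qed.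

Lemma quotient_mulg1 : right_id quotient_one quotient_mul.
Proof. by move=> a; rewrite -(quotient_proj_repr a) quotient_proj_mul mulg1. Qed.

Lemma quotient_mulVg : left_inverse quotient_one quotient_inv quotient_mul.
Proof.
move=> a; rewrite -(quotient_proj_repr a) quotient_proj_inv.
by rewrite quotient_proj_mul mulVg.
Qed.

Lemma quotient_mulgV : right_inverse quotient_one quotient_inv quotient_mul.
Proof.
move=> a; rewrite -(quotient_proj_repr a) quotient_proj_inv.
by rewrite quotient_proj_mul mulgV.
Qed.

HB.instance Definition _ := isGroup.Build quotient_group
  quotient_mulA quotient_mul1g quotient_mulg1 quotient_mulVg quotient_mulgV.

Lemma quotient_projM : {morph quotient_proj : x y / x * y}.
Proof. by move=> x y; rewrite -quotient_proj_mul. Qed.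

HB.instance Definition _ := isMultiplicative.Build G quotient_group
  quotient_proj quotient_projM.
HB.instance Definition _ := Multiplicative_isUMagmaMorphism.Build
  G quotient_group quotient_proj (morph_one quotient_projM).

End Quotient.

Definition normal_closure_set (G : groupType) (S : set G) : set G :=
  smallest (@is_normal_subgroup G) S.

Lemma normal_closure_setP (G : groupType) (S : set G) :
  is_normal_subgroup (normal_closure_set S).
Proof.
split; first split.
- by move=> M [[[]]].
- move=> x y hx hy M hM; have [[[_ h _] _] _] := hM.
  by apply: h; [exact: hx | exact: hy].
- by move=> x hx M hM; have [[[_ _ h] _] _] := hM; apply: h; exact: hx.
- by move=> x y hx M hM; have [[_ h] _] := hM; apply: h; exact: hx.
Qed.

Definition normal_closure (G : groupType) (S : set G) : normal_subgroup G :=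
  NormalSubgroup (normal_closure_setP S).

Definition derived_set (G : groupType) : set G :=
  smallest (@is_subgroup G) [set z | exists x y : G, z = [~ x, y]].

Lemma derived_setP (G : groupType) : is_normal_subgroup (@derived_set G).
Proof.
have sg : is_subgroup (@derived_set G).
  split.
  - by move=> M [[]].
  - move=> x y hx hy M hM; have [[_ h _] _] := hM.
    by apply: h; [exact: hx | exact: hy].
  - by move=> x hx M hM; have [[_ _ h] _] := hM; apply: h; exact: hx.
split=> // x y hx; have [d1 dM dV] := sg.
apply: (hx [set t | derived_set (t ^ y)]); split; first split => /=.
- by rewrite conj1g.
- by move=> a b; rewrite conjMg; exact: dM.
- by move=> a; rewrite conjVg; exact: dV.
- move=> _ [a [b ->]] /= M [_]; apply.
  by exists (a ^ y), (b ^ y); rewrite conjRg.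
Qed.

Definition derived_subgroup (G : groupType) : normal_subgroup G :=
  NormalSubgroup (@derived_setP G).

Definition abelianization (G : groupType) : groupType :=
  quotient_group (derived_subgroup G).

(* The free group on T: freely reduced words in the letters (t, false), which
   stands for t, and (t, true), which stands for t^-1. *)
Section FreeGroup.
Variable T : choiceType.

Definition letter : Type := (T * bool)%type.
HB.instance Definition _ := Choice.on letter.

Definition letter_inv (a : letter) : letter := (a.1, ~~ a.2).

Definition reduced (w : seq letter) : bool :=
  sorted (fun a b => b != letter_inv a) w.

Record free_group := FreeGroup { word :> seq letter; _ : reduced word }.

HB.instance Definition _ := [isSub for word].
HB.instance Definition _ := [Choice of free_group by <:].

Definition push (a : letter) (w : seq letter) : seq letter :=
  if w is b :: w' then (if b == letter_inv a then w' else a :: w) else [:: a].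

Definition word_mul (u v : seq letter) : seq letter := foldr push v u.
Definition word_inv (w : seq letter) : seq letter := rev (map letter_inv w).

Lemma letter_invK : involutive letter_inv.
Proof. by case=> t b; rewrite /letter_inv /= negbK. Qed.

Lemma push_reduced a w : reduced w -> reduced (push a w).
Proof.
case: w => [//|b w] /= h; case: eqP => [_|/eqP ne] /=; last by rewrite ne.
exact: path_sorted h.
Qed.

Lemma word_mul_reduced u v : reduced v -> reduced (word_mul u v).
Proof. by move=> hv; elim: u => //= a u IH; exact: push_reduced. Qed.

Lemma pushK a w : reduced w -> push a (push (letter_inv a) w) = w.
Proof.
case: w => [|b w] /=; first by rewrite eqxx.
rewrite letter_invK; case: eqP => [->|_ _]; last by rewrite /= eqxx.
by case: w => [//|c w] /= /andP[/negbTE ->].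
Qed.

Lemma word_mul_push a u w : reduced w ->
  word_mul (push a u) w = push a (word_mul u w).
Proof.
case: u => [//|b u] hw /=; case: eqP => [->|//].
by rewrite pushK // word_mul_reduced.
Qed.

Lemma word_mulA u v w : reduced w ->
  word_mul u (word_mul v w) = word_mul (word_mul u v) w.
Proof. by move=> hw; elim: u => //= a u ->; rewrite word_mul_push. Qed.

Lemma word_mul1 w : reduced w -> word_mul w [::] = w.
Proof.
elim: w => //= a w IH h; rewrite IH; last exact: path_sorted h.
by case: w h {IH} => //= b w /andP[/negbTE ->].
Qed.

Lemma word_inv_reduced w : reduced w -> reduced (word_inv w).
Proof.
rewrite /reduced /word_inv rev_sorted sorted_map; apply: sub_sorted => a b /=.
by apply: contraNN => /eqP h; rewrite h /= letter_invK.
Qed.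

Lemma word_mulVw w : reduced w -> word_mul (word_inv w) w = [::].
Proof.
rewrite /word_inv; elim: w => //= a w IH h.
rewrite rev_cons /word_mul foldr_rcons /= letter_invK eqxx.
exact/IH/path_sorted/h.
Qed.

Lemma word_invK : involutive word_inv.
Proof.
by move=> w; rewrite /word_inv map_rev revK -map_comp map_id_in // => a _ /=;
  rewrite letter_invK.
Qed.

Lemma word_mulwV w : reduced w -> word_mul w (word_inv w) = [::].
Proof.
by move=> h; rewrite -{1}(word_invK w); apply/word_mulVw/word_inv_reduced.
Qed.

Definition free_one : free_group := @FreeGroup [::] isT.
Definition free_mul (u v : free_group) : free_group :=
  FreeGroup (word_mul_reduced u (valP v)).
Definition free_inv (u : free_group) : free_group :=
  FreeGroup (word_inv_reduced (valP u)).

Lemma free_mulA : associative free_mul.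
Proof. by move=> u v w; apply/val_inj/word_mulA/(valP w). Qed.
Lemma free_mul1g : left_id free_one free_mul.
Proof. by move=> u; apply/val_inj. Qed.
Lemma free_mulg1 : right_id free_one free_mul.
Proof. by move=> u; apply/val_inj/word_mul1/(valP u). Qed.
Lemma free_mulVg : left_inverse free_one free_inv free_mul.
Proof. by move=> u; apply/val_inj/word_mulVw/(valP u). Qed.
Lemma free_mulgV : right_inverse free_one free_inv free_mul.
Proof. by move=> u; apply/val_inj/word_mulwV/(valP u). Qed.

HB.instance Definition _ := isGroup.Build free_group
  free_mulA free_mul1g free_mulg1 free_mulVg free_mulgV.

Definition free_gen (t : T) : free_group := @FreeGroup [:: (t, false)] isT.

Section Extension.
Variables (G : groupType) (f : T -> G).

Definition letter_val (a : letter) : G := if a.2 then (f a.1)^-1 else f a.1.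

Definition free_ext (w : free_group) : G :=
  \prod_(a <- word w) letter_val a.

Lemma free_ext_gen t : free_ext (free_gen t) = f t.
Proof. by rewrite /free_ext big_seq1. Qed.

Lemma free_extM : {morph free_ext : u v / u * v}.
Proof.
move=> [u hu] [v hv]; rewrite /free_ext /=; elim: u {hu} => [|a u IH] /=.
  by rewrite big_nil mul1g.
rewrite big_cons -mulgA -IH; case: (word_mul u v) => [|b w] /=.
  by rewrite big_seq1 big_nil mulg1.
case: eqP => [->|_]; last by rewrite [LHS]big_cons.
rewrite big_cons mulgA; case: a => t [] /=; rewrite /letter_val /=.
  by rewrite mulVg mul1g.
by rewrite mulgV mul1g.
Qed.

HB.instance Definition _ := isMultiplicative.Build free_group G
  free_ext free_extM.
HB.instance Definition _ := Multiplicative_isUMagmaMorphism.Build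
  free_group G free_ext (morph_one free_extM).

End Extension.
End FreeGroup.

(* A finite presentation <gens : rels>: the relators form a family indexed by a
   finite type, so that they are counted with multiplicity. *)
Record presentation := Presentation {
  gens : finType;
  rels : finType;
  relator : rels -> free_group gens }.

Definition presented_group (P : presentation) : groupType :=
  quotient_group (normal_closure (range (@relator P))).

Definition presents (P : presentation) (G : groupType) : Prop :=
  isomorphic (presented_group P) G.

Definition deficiency (P : presentation) : int :=
  (#|gens P|%:Z - #|rels P|%:Z)%R.

Definition balanced (P : presentation) : Prop := deficiency P = 0%R.

(* "G is finitely presented and has deficiency d" *)
Definition has_deficiency (G : groupType) (d : int) : Prop :=
  (exists2 P, presents P G & deficiency P = d) /\
  (forall P, presents P G -> (deficiency P <= d)%R).

Definition normally_generates (G : groupType) (n : nat) (s : n.-tuple G) : Prop :=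
  normal_closure [set x | x \in s] = setT :> set G.

Definition has_weight (G : groupType) (n : nat) : Prop :=
  (exists s : n.-tuple G, normally_generates s) /\
  (forall (m : nat) (s : m.-tuple G), normally_generates s -> (n <= m)%N).

Section Composition.
Variables (G H : presentation) (sigma : gens G -> rels H).

Definition comp_map : free_group (gens G) -> free_group (gens H) :=
  free_ext (fun u => relator (sigma u)).

HB.instance Definition _ := UMagmaMorphism.on comp_map.

(* Called a composition only when sigma is bijective. *)
Definition composition : presentation :=
  Presentation (fun v : rels G => comp_map (relator v)).

Definition natural_map (x : presented_group G) : presented_group composition :=
  quotient_proj _ (comp_map (repr x)).

Lemma natural_map_proj (w : free_group (gens G)) :
  natural_map (quotient_proj _ w) = quotient_proj _ (comp_map w).
Proof.
apply/quotient_projP; rewrite -gmulfF.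
have := (quotient_projP _ _ _).1 (quotient_proj_repr
  (quotient_proj (normal_closure (range (@relator G))) w)).
move: (_ / w) => z hz M [[[M1 MM MV] MJ] sM].
apply: (hz [set t | M (comp_map t)]); split; first split; first split => /=.
- by rewrite gmulf1.
- by move=> a b ha hb; rewrite gmulfM; exact: MM.
- by move=> a ha; rewrite gmulfV; exact: MV.
- by move=> a b /= ha; rewrite gmulfJ; exact: MJ.
- by move=> _ [r _ <-]; apply: sM; exists r.
Qed.

Lemma natural_mapM : {morph natural_map : x y / x * y}.
Proof.
move=> x y; rewrite -(quotient_proj_repr x) -(quotient_proj_repr y).
by rewrite -gmulfM !natural_map_proj -gmulfM -gmulfM.
Qed.

HB.instance Definition _ := isMultiplicative.Build _ _ natural_map natural_mapM.
HB.instance Definition _ := Multiplicative_isUMagmaMorphism.Build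
  _ _ natural_map (morph_one natural_mapM).

End Composition.

Definition B_datum (G H : presentation) (sigma : gens G -> rels H) : Prop :=
  [/\ infinite_cyclic (presented_group G) /\ deficiency G = 1%R,
      trivial_group (presented_group H) /\ balanced H,
      #|gens H| = #|gens G| & bijective sigma].

Definition in_B (P : presentation) : Prop :=
  exists (G H : presentation) (sigma : gens G -> rels H),
    B_datum sigma /\ P = composition sigma.

(* Main.v *)
From HB Require Import structures.
Require Import Defs.
From mathcomp Require Import all_boot all_order all_algebra.
From mathcomp Require Import boolp classical_sets.

(** Let [t] generate the infinite cyclic group presented by [G].  Any normal
    subgroup containing the image [z] of [t] contains the images of all the
    relators of [H], hence everything: [z] normally generates the composition.

    The relators of [H] normally generate the free group on its generators, so
    the square integer matrix of their exponent sums is right invertible, hence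
    invertible.  Consequently a homomorphism from that free group to the
    integers may be prescribed arbitrarily on the relators of [H]; prescribing
    the degrees of the generators of [G] yields a retraction of the natural
    map, which is therefore injective.  The retraction sends [z] to [1] and [z]
    generates the abelianization, which is thus infinite cyclic.

    Finally, the deficiency of a group is at most its weight: the relators of a
    presentation together with lifts of normal generators of the group normally
    generate the free group, so their exponent matrix is again right invertible,
    which over the rationals bounds the number of rows by that of columns. *)

Set Implicit Arguments.
Unset Strict Implicit.
Unset Printing Implicit Defensive.

Import Algebra GRing.Theory.
Local Open Scope classical_set_scope.
Local Open Scope group_scope.

(** * Homomorphisms and normal subgroups *)

Section Morphisms.
Variables (G H : groupType) (f : G -> H).
Hypothesis fM : {morph f : x y / x * y}.

Lemma morph_inv : {morph f : x / x^-1}.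
Proof.
by move=> x; apply: (mulgI (f x)); rewrite -fM !mulgV (morph_one fM).
Qed.

Lemma morph_conj : {morph f : x y / x ^ y}.
Proof. by move=> x y; rewrite !conjgE !fM morph_inv. Qed.

Lemma preimage_normal_subgroup (N : set H) :
  is_normal_subgroup N -> is_normal_subgroup (f @^-1` N).
Proof.
case=> -[N1 NM NV] NJ; split; first split; rewrite /preimage /=.
- by rewrite (morph_one fM).
- by move=> x y Nx Ny; rewrite fM; exact: NM.
- by move=> x Nx; rewrite morph_inv; exact: NV.
- by move=> x y Nx; rewrite morph_conj; exact: NJ.
Qed.

Lemma morph_can (g : H -> G) : cancel f g -> cancel g f ->
  {morph g : x y / x * y}.
Proof. by move=> fK gK x y; apply: (can_inj fK); rewrite fM !gK. Qed.

End Morphisms.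

(** Conjugation acts trivially on a commutative target. This allows two homomorphisms to be compared
    on normal generators only. *)
Lemma equalizer_normal_subgroup (G H : groupType) (f g : G -> H) :
    {morph f : x y / x * y} -> {morph g : x y / x * y} ->
    (forall x y : H, x * y = y * x) ->
  is_normal_subgroup [set x | f x = g x].
Proof.
move=> fM gM HC; split; first split => /=.
- by rewrite (morph_one fM) (morph_one gM).
- by move=> x y fgx fgy; rewrite fM gM fgx fgy.
- by move=> x fgx; rewrite (morph_inv fM) (morph_inv gM) fgx.
- move=> x y /= fgx; rewrite (morph_conj fM) (morph_conj gM) !conjgE fgx.
  by rewrite !(HC (g x)) !mulKg.
Qed.

Lemma trivial_normal_subgroup (G : groupType) : is_normal_subgroup [set 1 : G].
Proof.
split; first split => //=.
- by move=> x y -> ->; rewrite mulg1.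
- by move=> x ->; rewrite invg1.
- by move=> x y /= ->; rewrite conj1g.
Qed.

Lemma normally_generatesP (G : groupType) (n : nat) (s : n.-tuple G) :
  normally_generates s <-> forall N : set G,
    is_normal_subgroup N -> (forall x, x \in s -> N x) -> forall x, N x.
Proof.
split=> [gen_s N nN sN x|gen_s].
- have : normal_carrier (normal_closure [set y | y \in s]) x by rewrite gen_s.
  by apply; split.
- apply/seteqP; split=> // x _ N [nN sN]; exact: gen_s nN sN x.
Qed.

Lemma normally_generates_bijective (G H : groupType) (f : G -> H) (g : H -> G)
    (n : nat) (s : n.-tuple H) :
    {morph f : x y / x * y} -> cancel f g -> cancel g f ->
  normally_generates s -> normally_generates (map_tuple g s).
Proof.
move=> fM fK gK /normally_generatesP gen_s; apply/normally_generatesP.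
move=> N nN sN x; rewrite -(fK x).
apply: (gen_s (g @^-1` N)) => [|y sy].
  exact: preimage_normal_subgroup (morph_can fM fK gK) _ nN.
by apply: sN; apply: map_f.
Qed.

(** * Induced maps on quotients, and abelianizations *)

Section QuotientLift.
Variables (G H : groupType) (N : normal_subgroup G) (f : G -> H).
Hypotheses (fM : {morph f : x y / x * y})
  (fN : forall x, normal_carrier N x -> f x = 1).

(** Two representatives of a coset differ by an element of [N], which [f] kills; so composing [f]
    with [repr] gives the induced map. *)
Lemma lift_proj (x : G) : f (repr (quotient_proj N x)) = f x.
Proof.
have /quotient_projP/fN := quotient_proj_repr (quotient_proj N x).
rewrite fM (morph_inv fM) => /(congr1 (fun y => y * f x)).
by rewrite mulgVK mul1g.
Qed.

Lemma liftM : {morph (fun a : quotient_group N => f (repr a)) : a b / a * b}.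
Proof.
move=> a b; rewrite -{1}(quotient_proj_repr a) -{1}(quotient_proj_repr b).
by rewrite -quotient_projM lift_proj fM.
Qed.

End QuotientLift.

Lemma abelianization_mulC (G : groupType) (a b : abelianization G) :
  a * b = b * a.
Proof.
rewrite -(quotient_proj_repr a) -(quotient_proj_repr b) -!quotient_projM.
(* The quotient of [x * y] by [y * x] is the commutator of [x^-1] and [y^-1]. *)
apply/quotient_projP => M [_]; apply; exists (repr a)^-1, (repr b)^-1.
by rewrite commgEl conjgE !invgK invgM !mulgA.
Qed.

Lemma derived_ker (G H : groupType) (f : G -> H) :
    {morph f : x y / x * y} -> (forall x y : H, x * y = y * x) ->
  forall x, derived_set x -> f x = 1.
Proof.
move=> fM HC x dx; apply: (dx (f @^-1` [set 1])); split.
  exact: (preimage_normal_subgroup fM (@trivial_normal_subgroup H)).1.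
move=> _ [a [b ->]] /=.
rewrite commgEl fM (morph_inv fM) (morph_conj fM) conjgE.
by rewrite HC (HC (f a)) mulKg mulgV.
Qed.

(** * Homomorphisms from a free group to a ring *)

Lemma free_group_ind (T : choiceType) (N : set (free_group T)) :
  is_subgroup N -> (forall t, N (free_gen t)) -> forall w, N w.
Proof.
move=> [N1 NM NV] Ngen [u hu]; elim: u hu => [|a u IH] hu.
  by rewrite (_ : FreeGroup hu = 1) //; exact: val_inj.
have ru : reduced u by exact: path_sorted hu.
(* The word is reduced, so multiplying its tail by its first letter cancels nothing. *)
rewrite (_ : FreeGroup hu = @FreeGroup T [:: a] isT * FreeGroup ru); last first.
  apply: val_inj => /=; case: (u) hu => //= b u' /andP[/negbTE ->] //.
apply: NM => //; case: a {hu} => t [|]; last exact: Ngen.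
rewrite (_ : FreeGroup _ = (free_gen t)^-1); last exact: val_inj.
exact/NV/Ngen.
Qed.

Lemma eq_free_morph (T : choiceType) (H : groupType) (f g : free_group T -> H) :
    {morph f : x y / x * y} -> {morph g : x y / x * y} ->
    (forall t, f (free_gen t) = g (free_gen t)) ->
  f =1 g.
Proof.
move=> fM gM fg; apply: free_group_ind => //; split=> /=.
- by rewrite (morph_one fM) (morph_one gM).
- by move=> x y fgx fgy; rewrite fM gM fgx fgy.
- by move=> x fgx; rewrite (morph_inv fM) (morph_inv gM) fgx.
Qed.

(** Meant for the dimensions [#|T|] and [#|U|], which are provably equal but not convertible. *)
Lemma mulmx1C_rect (R : comPzRingType) (m n : nat) (A : 'M[R]_(m, n))
    (B : 'M[R]_(n, m)) :
  m = n -> (A *m B = 1%:M -> B *m A = 1%:M)%R.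
Proof. by move=> mn; subst m; exact: mulmx1C. Qed.

Section ExponentSums.
Variables (R : comNzRingType) (T : finType).
Local Open Scope ring_scope.

Definition weighted_sum (w : T -> R) (x : free_group T) : R :=
  free_ext (w : T -> to_multiplicative R) x.

Definition exponent (t : T) : free_group T -> R :=
  weighted_sum (fun u => (u == t)%:R).

Lemma weighted_sumM w x y :
  weighted_sum w (x * y)%g = weighted_sum w x + weighted_sum w y.
Proof. exact: (@free_extM T (to_multiplicative R)). Qed.

Lemma weighted_sum_gen w t : weighted_sum w (free_gen t) = w t.
Proof. exact: (@free_ext_gen T (to_multiplicative R)). Qed.

Lemma weighted_sum_morph (w : T -> R) :
  {morph (weighted_sum w : free_group T -> to_multiplicative R) :
     x y / (x * y)%g}.
Proof. exact: weighted_sumM. Qed.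

Lemma weighted_sumE w x : weighted_sum w x = \sum_t w t * exponent t x.
Proof.
apply: (@eq_free_morph T (to_multiplicative R) (weighted_sum w)
  (fun x => \sum_t w t * exponent t x)); first exact: weighted_sum_morph.
- move=> y z; rewrite -[RHS]big_split /=; apply: eq_bigr => t _.
  by rewrite -mulrDr -weighted_sumM.
- move=> u; rewrite weighted_sum_gen (bigD1 u) //= big1 ?addr0 => [|t tu].
    by rewrite /exponent weighted_sum_gen eqxx mulr1.
  by rewrite /exponent weighted_sum_gen eq_sym (negbTE tu) mulr0.
Qed.

Variables (U : finType) (r : U -> free_group T).

(** The relation matrix of the abelianized presentation, with one column per relator. *)
Definition exponent_mx : 'M[R]_(#|T|, #|U|) :=
  \matrix_(i, j) exponent (enum_val i) (r (enum_val j)).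

Lemma weighted_sum_mx (w : 'rV[R]_#|T|) (u : U) :
  weighted_sum (fun t => w 0 (enum_rank t)) (r u) =
  (w *m exponent_mx) 0 (enum_rank u).
Proof.
rewrite weighted_sumE mxE (reindex (@enum_val T T)) /=; last first.
  exact/onW_bij/enum_val_bij.
by apply: eq_bigr => i _; rewrite mxE enum_valK enum_rankK.
Qed.

Hypothesis r_gen : forall x, normal_closure_set (range r) x.

(** Exponent sums are additive and invariant under conjugation, so the elements with exponent vector
    in the column span form a normal subgroup. It contains each [r u], whose vector is a column. *)
Lemma exponent_mx_span (x : free_group T) :
  exists c : 'cV[R]_#|U|,
    forall i, exponent (enum_val i) x = (exponent_mx *m c) i 0.
Proof.
have expV t y : exponent t y^-1%g = - exponent t y.
  exact: (morph_inv (weighted_sum_morph _)).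
pose spanned (y : free_group T) := exists c : 'cV[R]_#|U|,
  forall i, exponent (enum_val i) y = (exponent_mx *m c) i 0.
apply: (@r_gen x spanned); split; first split; first split => /=.
- exists 0 => i; rewrite mulmx0 mxE.
  exact: (morph_one (weighted_sum_morph _)).
- move=> y z [c hc] [d hd]; exists (c + d) => i.
  by rewrite mulmxDr mxE -hc -hd -weighted_sumM.
- by move=> y [c hc]; exists (- c) => i; rewrite mulmxN mxE -hc expV.
- move=> y z [c hc]; exists c => i; rewrite -hc conjgE /exponent !weighted_sumM.
  by rewrite -/(exponent _ _) expV addrCA addNr addr0.
- move=> _ [u _ <-]; exists (delta_mx (enum_rank u) 0) => i.
  by rewrite -colE mxE mxE enum_rankK.
Qed.

Lemma exponent_mx_rinv : exists C : 'M[R]_(#|U|, #|T|), exponent_mx *m C = 1%:M.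
Proof.
have /fin_all_exists[c hc] (j : 'I_#|T|) :=
  exponent_mx_span (free_gen (enum_val j)).
(* The exponent vectors of the generators are the standard basis, so their coefficient vectors are
   the columns of a right inverse. *)
exists (\matrix_(i, j) c j i 0); apply/matrixP => i j; rewrite !mxE.
transitivity ((exponent_mx *m c j) i 0).
  by rewrite mxE; apply: eq_bigr => k _; rewrite !mxE.
by rewrite -hc /exponent weighted_sum_gen (inj_eq enum_val_inj) eq_sym.
Qed.

Lemma weighted_sum_prescribed : #|T| = #|U| -> forall d : U -> R,
  exists w : T -> R, forall u, weighted_sum w (r u) = d u.
Proof.
move=> cardTU d; have [C /(mulmx1C_rect cardTU) CS1] := exponent_mx_rinv.
pose w := (\row_j d (enum_val j)) *m C.
exists (fun t => w 0 (enum_rank t)) => u.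
by rewrite weighted_sum_mx -mulmxA CS1 mulmx1 mxE enum_rankK.
Qed.

End ExponentSums.

(** * Deficiency and numbers of normal generators *)

Lemma leq_card_normal_generators (T U : finType) (r : U -> free_group T) :
  (forall x, normal_closure_set (range r) x) -> (#|T| <= #|U|)%N.
Proof. by move/(exponent_mx_rinv rat) => [C /mulmx1_min]. Qed.

Lemma deficiency_le_normal_generators (P : presentation) (n : nat)
    (s : n.-tuple (presented_group P)) :
  normally_generates s -> (deficiency P <= n%:Z)%R.
Proof.
move=> /normally_generatesP gen_s.
pose r (u : rels P + 'I_n) :=
  match u with inl v => relator v | inr i => repr (tnth s i) end.
suff /leq_card_normal_generators : forall x, normal_closure_set (range r) x.
  by rewrite card_sum card_ord /deficiency Num.Theory.lerBlDl -PoszD lez_nat.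
have nr := normal_closure_setP (range r).
have [[_ rM _] _] := nr.
have rel_r v : normal_closure_set (range r) (relator (p:=P) v).
  by move=> N [_]; apply; exists (inl v).
(* If the normal closure of [r] maps onto the presented group, any [x] differs from one of its
   elements by a consequence of the relators, which also lies in it. *)
suff all_r (a : presented_group P) :
    exists2 x, normal_closure_set (range r) x & quotient_proj _ x = a.
  move=> x; have [y ry /esym/quotient_projP xy] := all_r (quotient_proj _ x).
  rewrite -(mulgVK y x); apply: rM => //; apply: xy; split=> //.
  by move=> _ [v _ <-].
pose M : set (presented_group P) :=
  quotient_proj _ @` normal_closure_set (range r).
apply: (gen_s M) => [|_ /tnthP[i ->]]; last first.
  exists (repr (tnth s i)); last exact: quotient_proj_repr.
  by move=> N [_]; apply; exists (inr i).
have [[r1 _ rV] rJ] := nr.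
split; first split=> /=.
- by exists 1; rewrite ?(morph_one (@quotient_projM _ _)).
- move=> _ _ [x rx <-] [y ry <-]; exists (x * y); first exact: rM.
  exact: quotient_projM.
- move=> _ [x rx <-]; exists x^-1; first exact: rV.
  exact: (morph_inv (@quotient_projM _ _)).
- move=> _ b [x rx <-]; exists (x ^ repr b); first exact: rJ.
  by rewrite (morph_conj (@quotient_projM _ _)) quotient_proj_repr.
Qed.

(** * Compositions *)

Lemma trivial_presented_groupP (P : presentation) :
    trivial_group (presented_group P) ->
  forall x, normal_closure_set (range (@relator P)) x.
Proof.
move=> trivP x; have := trivP (quotient_proj _ x).
rewrite -(morph_one (@quotient_projM _ _)) => /quotient_projP.
by rewrite invg1 mulg1.
Qed.

Lemma natural_map_normal_generator (G H : presentation)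
    (sigma : gens G -> rels H) (t : presented_group G) :
    trivial_group (presented_group H) -> bijective sigma ->
    normally_generates [tuple t] ->
  normally_generates [tuple natural_map sigma t].
Proof.
move=> trivH [tau _ tauK] /normally_generatesP gen_t; apply/normally_generatesP.
move=> N nN zN a; rewrite -(quotient_proj_repr a); set x := repr a.
apply: (@trivial_presented_groupP H trivH x (quotient_proj _ @^-1` N)); split.
  exact: preimage_normal_subgroup (@quotient_projM _ _) _ nN.
(* As [sigma] is onto, the class of each relator of [H] is the natural image of a generator of
   [G]. *)
move=> _ [v _ <-] /=; rewrite -(tauK v).
have := natural_map_proj sigma (free_gen (tau v)).
rewrite /comp_map free_ext_gen => <-.
apply: (gen_t (natural_map sigma @^-1` N)).
  exact: preimage_normal_subgroup (@natural_mapM _ _ sigma) _ nN.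
by move=> b; rewrite inE => /eqP ->; apply: zN; rewrite inE.
Qed.

Lemma natural_map_extension (G H : presentation) (sigma : gens G -> rels H)
    (R : comNzRingType) (f : presented_group G -> to_multiplicative R) :
    trivial_group (presented_group H) -> balanced H -> bijective sigma ->
    {morph f : x y / x * y} ->
  exists2 g : presented_group (composition sigma) -> to_multiplicative R,
    {morph g : x y / x * y} & forall x, g (natural_map sigma x) = f x.
Proof.
move=> trivH balH [tau sigmaK tauK] fM.
have gen_rel := trivial_presented_groupP trivH.
have cardH : #|gens H| = #|rels H|.
  by move/eqP: balH; rewrite subr_eq0 => /eqP[].
(* Each relator of [H] receives the value of [f] at the matching generator of [G]. *)
have [w wE] := weighted_sum_prescribed gen_rel cardH
  (fun v => f (quotient_proj _ (free_gen (tau v)))).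
pose phi : free_group (gens H) -> to_multiplicative R := weighted_sum w.
have phiM : {morph phi : x y / x * y} by exact: weighted_sum_morph.
have phi_comp x : phi (comp_map sigma x) = f (quotient_proj _ x).
  move: x; apply: eq_free_morph => [x y|x y|u].
  - by rewrite /comp_map free_extM phiM.
  - by rewrite quotient_projM fM.
  - by rewrite /comp_map free_ext_gen /phi wE sigmaK.
have phi_ker x :
    normal_carrier (normal_closure (range (@relator (composition sigma)))) x ->
    phi x = 1.
  move=> kx; apply: (kx (phi @^-1` [set 1])); split.
    exact: preimage_normal_subgroup phiM _ (@trivial_normal_subgroup _).
  (* Relators of the composition come from relators of [G], which are already trivial in the group
     of [G]. *)
  move=> _ [v _ <-] /=; rewrite phi_comp -(morph_one fM); congr (f _).
  apply/quotient_projP; rewrite invg1 mulg1 => N [_]; apply.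
  by exists v.
exists (fun a => phi (repr a)); first exact: liftM.
move=> x; rewrite -{2}(quotient_proj_repr x) -phi_comp.
exact: lift_proj.
Qed.

(** * The integers, abelianization and weight *)

Lemma int_normal_generator :
  normally_generates [tuple (1%R : to_multiplicative int)].
Proof.
apply/normally_generatesP => N [[N0 NM NV] _] N1.
(* [1%R] is the integer one, whereas the identity of this group is the integer zero. *)
have {}N1 : N 1%R by apply: N1; rewrite inE.
have Nn (n : nat) : N (n%:Z)%R.
  by elim: n => // n IH; rewrite -addn1 PoszD; exact: NM IH N1.
by case=> n; [exact: Nn | rewrite NegzE; exact: NV (Nn n.+1)].
Qed.

Lemma infinite_cyclic_abelianization (K : groupType)
    (f : K -> to_multiplicative int) (h : to_multiplicative int -> K) :
    {morph f : x y / x * y} -> {morph h : x y / x * y} -> cancel h f ->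
    normally_generates [tuple h 1%R] ->
  infinite_cyclic (abelianization K).
Proof.
move=> fM hM hK /normally_generatesP gen_h.
pose N := derived_subgroup K.
have f_ker x : normal_carrier N x -> f x = 1.
  by apply: derived_ker => // x' y'; exact: addrC.
pose F (a : abelianization K) : to_multiplicative int := f (repr a).
have FM : {morph F : a b / a * b} by exact: liftM.
pose Fmul :=
  isMultiplicative.Build (abelianization K) (to_multiplicative int) F FM.
pose Fbundled : {multiplicative abelianization K -> to_multiplicative int} :=
  HB.pack F Fmul.
exists Fbundled; exists (fun k => quotient_proj N (h k)); last first.
  by move=> k; rewrite /= /F lift_proj.
move=> a; rewrite -{2}(quotient_proj_repr a) /= /F.
(* Both sides are homomorphisms into a commutative group, so agreement at the normal generator
   [h 1%R] suffices. *)
apply: (gen_h [set x | quotient_proj N (h (f x)) = quotient_proj N x]).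
  apply: equalizer_normal_subgroup => [x y|x y|].
  - by rewrite fM hM quotient_projM.
  - exact: quotient_projM.
  - exact: abelianization_mulC.
by move=> x; rewrite inE => /eqP -> /=; rewrite hK.
Qed.

Lemma has_weight_one (K : groupType) (z : K) :
  z <> 1 -> normally_generates [tuple z] -> has_weight K 1.
Proof.
move=> z1 gen_z; split; first by exists [tuple z].
(* Weight zero would make the group trivial. *)
move=> [|m] // s /normally_generatesP gen_s; case: z1.
by apply: (gen_s _ (@trivial_normal_subgroup K)) => x; rewrite tuple0.
Qed.

(** Common source of all the claims: [h] identifies the integers with the group of [G], and [g]
    extends the inverse of [h] along the natural map. *)
Lemma B_datum_retract (G H : presentation) (sigma : gens G -> rels H) :
    B_datum sigma ->
  exists (g : presented_group (composition sigma) -> to_multiplicative int)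
         (h : to_multiplicative int -> presented_group G),
    [/\ {morph g : x y / x * y}, {morph h : x y / x * y},
        bijective h, cancel (natural_map sigma \o h) g
      & normally_generates [tuple natural_map sigma (h 1%R)]].
Proof.
case=> -[[f [h fK hK]] _] [trivH balH] _ bij_sigma.
have fM : {morph f : x y / x * y} by exact: gmulfM.
have [g gM gf] := natural_map_extension trivH balH bij_sigma fM.
exists g, h; split=> //; first exact (morph_can fM fK hK).
- by exists f.
- by move=> k /=; rewrite gf hK.
apply: natural_map_normal_generator => //.
have := normally_generates_bijective fM fK hK int_normal_generator.
by congr normally_generates; exact: val_inj.
Qed.

Theorem lemma3p7 :
  (forall P : presentation, in_B P ->
     [/\ has_weight (presented_group P) 1,
         infinite_cyclic (abelianization (presented_group P))
       & has_deficiency (presented_group P) 1%R]) /\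
  (forall (G H : presentation) (sigma : gens G -> rels H),
     B_datum sigma -> injective (@natural_map G H sigma)).
Proof.
split=> [_ [G [H [sigma [datum ->]]]]|G H sigma datum]; last first.
  have [g [h [_ _ [f fK hK] ghK _]]] := B_datum_retract datum.
  apply: (@can_inj _ _ _ (h \o g)) => x.
  by rewrite -(hK x) /=; congr (h _); exact: ghK.
have [g [h [gM hM _ ghK gen_z]]] := B_datum_retract datum.
split.
(* The retraction sends this generator to the integer one, so it is not trivial. *)
- apply: has_weight_one gen_z => z1.
  by have := ghK 1%R; rewrite /= z1 (morph_one gM).
- apply: (infinite_cyclic_abelianization gM _ ghK gen_z) => x y /=.
  by rewrite hM natural_mapM.
- split.
    (* The composition has as many generators and relators as [G], hence deficiency one. *)
    exists (composition sigma).
      by exists (idfun : {multiplicative _ -> _}); exists id.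
    by case: datum => -[_ defG] _ cardHG _; rewrite -defG /deficiency /= cardHG.
  (* The single normal generator, transported to any other presentation, bounds its deficiency by
     one. *)
  move=> P [f [f' fK f'K]].
  apply: deficiency_le_normal_generators.
  exact: normally_generates_bijective (gmulfM (s:=f)) fK f'K gen_z.
Qed.
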